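(* The group $\mathrm{WPic}_{\mathbb{Z}\langle G\rangle}$ is finite; that is, for fixed $G$ and $u$ there are only finitely many $G$-isomorphism classes of invertible $G$-lattices.
   Context: Let $G$ be a finite abelian group with a fixed element $u$ of order $2$ and $n=\#G/2$. A lattice is a finitely generated abelian group with a bilinear, symmetric, positive definite $\mathbb{Z}$-valued form. A $G$-lattice is a lattice with a homomorphism from $G$ to its form-preserving automorphisms in which $u$ acts as $-1$; $G$-isomorphisms are form-preserving group isomorphisms commuting with the actions. A $G$-lattice $L$ is invertible if it has rank $n$, Gram determinant $1$, and for every $m\in\mathbb{Z}_{>0}$ some $e_m\in L$ has $\{\sigma e_m+mL:\sigma\in G\}$ generating $L/mL$ as an abelian group. $\mathrm{WPic}_{\mathbb{Z}\langle G\rangle}$ is the set of $G$-isomorphism classes of invertible $G$-lattices, with group law given by tensor product over $\mathbb{Z}\langle G\rangle=\mathbb{Z}[G]/(u+1)$. *)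

(* Defs.v *)
From HB Require Import structures.
From mathcomp Require Import all_boot all_order all_fingroup all_algebra.

Set Implicit Arguments.
Unset Strict Implicit.
Unset Printing Implicit Defensive.

Import Order.TTheory GRing.Theory Num.Theory.
Local Open Scope ring_scope.

Definition int_span (L : zmodType) (I : finType) (b : I -> L) (x : L) : Prop :=
  exists c : I -> int, x = \sum_(i : I) b i *~ c i.

Definition finitely_generated (L : zmodType) : Prop :=
  exists (k : nat) (b : 'I_k -> L), forall x : L, int_span b x.

Record lattice : Type := Lattice {
  lat_sort :> zmodType;
  form : lat_sort -> lat_sort -> int;
  lat_fg : finitely_generated lat_sort;
  formDl : forall x y z, form (x + y) z = form x z + form y z;
  formDr : forall x y z, form x (y + z) = form x y + form x z;
  formC : forall x y, form x y = form y x;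
  form_posdef : forall x, x != 0 -> 0 < form x x
}.

(* The axioms make each [act s] an automorphism, with inverse [act s^-1]. *)
Record glattice (G : finGroupType) (u : G) : Type := GLattice {
  glat :> lattice;
  act : G -> glat -> glat;
  act1 : forall x, act 1%g x = x;
  actM : forall s t x, act (s * t)%g x = act s (act t x);
  actD : forall s x y, act s (x + y) = act s x + act s y;
  act_form : forall s x y, form (act s x) (act s y) = form x y;
  act_u : forall x, act u x = - x
}.

Definition giso (G : finGroupType) (u : G) (L M : glattice u) : Prop :=
  exists f : {additive L -> M},
    [/\ bijective f,
        forall x y, form (f x) (f y) = form x y
      & forall s x, f (act s x) = act s (f x)].

Definition zbasis (L : zmodType) (k : nat) (b : 'I_k -> L) : Prop :=
  (forall x : L, int_span b x) /\
  (forall c : 'I_k -> int, \sum_(i < k) b i *~ c i = 0 -> forall i, c i = 0).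

(* A lattice is torsion-free (its form is positive definite) and finitely
   generated, hence free: its rank is the size of its bases. *)
Definition has_rank (L : lattice) (k : nat) : Prop :=
  exists b : 'I_k -> L, zbasis b.

Definition gram (L : lattice) (k : nat) (b : 'I_k -> L) : 'M[int]_k :=
  \matrix_(i, j) form (b i) (b j).

Definition has_gram_det (L : lattice) (d : int) : Prop :=
  exists (k : nat) (b : 'I_k -> L), zbasis b /\ \det (gram b) = d.

(* The cosets s e + mL generate L/mL iff every x in L is congruent mod mL to
   an integer combination of the s e. *)
Definition generates_mod (G : finGroupType) (u : G) (L : glattice u)
    (m : nat) (e : L) : Prop :=
  forall x : L, exists y : L, int_span (fun s : G => act s e) (x - y *+ m).

Definition invertible (G : finGroupType) (u : G) (L : glattice u) : Prop :=
  [/\ has_rank L (#|G| %/ 2),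
      has_gram_det L 1
    & forall m : nat, (0 < m)%N -> exists e : L, generates_mod m e].

(* MathComp-Analysis's [set] and [finite_set] cannot be used here: their
   universe lies strictly below that of [zmodType], hence of [glattice]. *)
Definition finite_pred (T : Type) (P : T -> Prop) : Prop :=
  exists (k : nat) (F : 'I_k -> T), forall x : T, P x <-> exists i, x = F i.

(* A class is a predicate on G-lattices; WPic is the collection of those of the
   form [giso L] with L invertible. *)
Definition WPic (G : finGroupType) (u : G) (C : glattice u -> Prop) : Prop :=
  exists2 L : glattice u, invertible L & C = giso L.

(* Main.v *)
From Pilot Require Import Defs.
From HB Require Import structures.
From mathcomp Require Import all_boot all_order all_fingroup all_algebra.
From mathcomp Require Import zify ring.
From Stdlib Require Import Classical FunctionalExtensionality
  PropExtensionality.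
(* [form] is also a name of MathComp's sesquilinear library. *)
Import Pilot.Defs.

(** Hermite reduction bounds the Gram matrix of a suitable basis of a positive
    definite integral lattice in terms of its rank and determinant.  For such a
    basis b of a G-lattice, Cauchy-Schwarz then bounds all the integers
    <s b_i, b_j>, s in G, because s preserves the form; and these integers
    determine the G-lattice up to G-isomorphism, because the form is
    nondegenerate. *)

Set Implicit Arguments.
Unset Strict Implicit.
Unset Printing Implicit Defensive.

Import Order.TTheory GRing.Theory Num.Theory.
Local Open Scope ring_scope.

(** * Minimal elements, and finiteness from finitely many codes *)

Lemma ex_minimizer (T : Type) (P : T -> Prop) (f : T -> nat) :
  (exists x, P x) -> exists2 x, P x & forall y, P y -> (f x <= f y)%N.
Proof.
case=> x Px; have [m] := ubnP (f x).
elim: m x Px => // m IHm x Px lt_fx_m.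
have [[y [Py lt_yx]]|min_x] := classic (exists y, P y /\ (f y < f x)%N).
  by apply: (IHm y) => //; lia.
exists x => // y Py; rewrite leqNgt; apply/negP => lt_yx.
by apply: min_x; exists y.
Qed.

(* No [seq T] occurs in the proof: the universe of [seq] lies strictly below
   that of [zmodType], hence of the classes of G-lattices. *)
Lemma finite_pred_codes (K : finType) (T : Type) (P : T -> Prop)
    (code : K -> T -> Prop) :
    (forall x, P x -> exists k, code k x) ->
    (forall k x y, P x -> P y -> code k x -> code k y -> x = y) ->
  finite_pred P.
Proof.
move=> ex_code code_inj.
(* Induction on the list of codes: [F] gains one value for each code carried by an element of [P],
   and whether there is such an element is decided classically. *)
have coded (s : seq K) : exists (k : nat) (F : 'I_k -> T),
    forall x, (P x /\ exists2 c, c \in s & code c x) <-> exists i, x = F i.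
  elim: s => [|c s [k [F FP]]].
    have F (i : 'I_0) : T by case: i.
    by exists 0, F => x; split=> [[_ []]|[[]]].
  have [[x [Px cx]]|no_x] := classic (exists x, P x /\ code c x).
    exists k.+1, (fun i => if unlift ord0 i is Some j then F j else x) => y.
    split=> [[Py [c']]|[i ->]].
      rewrite inE => /predU1P[-> cy|sc' c'y].
        by exists ord0; rewrite unlift_none; apply: (code_inj c).
      have [|i ->] := (FP y).1; first by split=> //; exists c'.
      by exists (lift ord0 i); rewrite liftK.
    case: unliftP => [j|] _; last by split=> //; exists c; rewrite ?mem_head.
    have [|Py [c' sc' c'y]] := (FP (F j)).2; first by exists j.
    by split=> //; exists c'; rewrite // inE sc' orbT.
  exists k, F => y; rewrite -FP; split=> -[Py [c' sc' c'y]]; split=> //.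
    exists c' => //; move: sc'; rewrite inE => /predU1P[eq_c|//].
    by case: no_x; exists y; rewrite -eq_c.
  by exists c'; rewrite // inE sc' orbT.
have [k [F FP]] := coded (enum K); exists k, F => x; rewrite -FP.
split=> [Px|[]//]; split=> //.
by have [c cx] := ex_code x Px; exists c; rewrite ?mem_enum.
Qed.

(** * Hermite reduction *)

Definition posdefmx (n : nat) (A : 'M[int]_n) : Prop :=
  A^T = A /\ forall x : 'rV[int]_n, x != 0 -> 0 < (x *m A *m x^T) 0 0.

Lemma posdefmx_congr (n : nat) (A U : 'M[int]_n) :
  U \in unitmx -> posdefmx A -> posdefmx (U *m A *m U^T).
Proof.
move=> uU [symA posA]; split=> [|x x0].
  by rewrite !trmx_mul trmxK symA mulmxA.
have -> : x *m (U *m A *m U^T) *m x^T = (x *m U) *m A *m (x *m U)^T.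
  by rewrite trmx_mul !mulmxA.
apply: posA; apply: contraNneq x0 => xU0.
by rewrite -(mulmxK uU x) xU0 mul0mx.
Qed.

Lemma congr_diagE (n : nat) (A U : 'M[int]_n) (i : 'I_n) :
  (U *m A *m U^T) i i = (row i U *m A *m (row i U)^T) 0 0.
Proof.
have -> : (row i U)^T = col i U^T by apply/colP=> j; rewrite !mxE.
by rewrite colE mulmxA -!row_mul -colE [RHS]mxE [in RHS]mxE.
Qed.

Lemma row_unitmx_neq0 (n : nat) (U : 'M[int]_n) (i : 'I_n) :
  U \in unitmx -> row i U != 0.
Proof.
move=> uU; apply/eqP => /(congr1 (mulmx^~ (invmx U))).
rewrite -row_mul mulmxV // mul0mx => /rowP/(_ i).
by rewrite !mxE eqxx.
Qed.

Lemma posdefmx_diag_gt0 (n : nat) (A : 'M[int]_n) (i : 'I_n) :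
  posdefmx A -> 0 < A i i.
Proof.
move=> [_ posA]; have := posA _ (row_unitmx_neq0 i (unitmx1 _ n)).
by rewrite -congr_diagE trmx1 mulmx1 mul1mx.
Qed.

(** For A with blocks a, r, r^T, D, this is a times the Gram matrix of the
    projection of the lattice orthogonally to its first basis vector; the
    scaling by a keeps it integral. *)
Definition projmx (n : nat) (a : int) (r : 'rV[int]_n) (D : 'M[int]_n) :=
  a *: D - r^T *m r.

Lemma block_mx_scalar00 (n : nat) (a : int) (r : 'rV[int]_n) (c : 'cV[int]_n)
    (D : 'M[int]_n) :
  block_mx a%:M r c D ord0 ord0 = a.
Proof.
have -> : ord0 = lshift n (ord0 : 'I_1) :> 'I_(1 + n) by apply: val_inj.
by rewrite block_mxEul mxE.
Qed.

(** Left multiplication by [E], of determinant [a ^+ n], scales the last [n] rows by [a] and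
    subtracts [r^T] times the first row, which clears the first column below [a]. *)
Lemma det_projmx (n : nat) (a : int) (r : 'rV[int]_n) (D : 'M[int]_n) :
  a ^+ n * \det (block_mx a%:M r r^T D) = a * \det (projmx a r D).
Proof.
pose E := block_mx (1%:M : 'M[int]_1) 0 (- r^T) (a%:M : 'M[int]_n).
have : E *m block_mx a%:M r r^T D = block_mx a%:M r 0 (projmx a r D).
  rewrite mulmx_block !mul1mx !mul0mx !addr0 mul_mx_scalar mul_scalar_mx.
  by rewrite scalerN addNr mul_scalar_mx mulNmx addrC.
move=> /(congr1 determinant); rewrite det_mulmx det_lblock det_ublock.
by rewrite !det_scalar expr1n mul1r expr1.
Qed.

Lemma posdefmx_projmx (n : nat) (a : int) (r : 'rV[int]_n) (D : 'M[int]_n) :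
  0 < a -> posdefmx (block_mx a%:M r r^T D) -> posdefmx (projmx a r D).
Proof.
move=> a_gt0 [symA posA]; split=> [|x x0].
  have symD : D^T = D.
    by move: symA; rewrite tr_block_mx trmxK => /eq_block_mx[].
  by rewrite linearB linearZ /= trmx_mul trmxK symD.
(* This vector lifts [a *: x] and is orthogonal to the first basis vector; the form there is [a]
   times the value of [projmx a r D] at [x]. *)
have := posA (row_mx (- (x *m r^T)) (a *: x)) _.
rewrite mul_row_block mul_mx_scalar tr_row_mx mul_row_col -scalemxAl.
rewrite scalerN addNr mul0mx add0r linearZ /= -scalemxAr mxE.
have -> : - (x *m r^T) *m r + a *: x *m D = x *m projmx a r D.
  by rewrite mulmxBr mulNmx mulmxA addrC -scalemxAr -scalemxAl.
rewrite pmulr_rgt0 //; apply; apply: contra x0.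
move=> /eqP/(congr1 rsubmx); rewrite row_mxKr linear0 => /rowP ax0.
apply/eqP/rowP=> i; have := ax0 i; rewrite !mxE => /eqP.
by rewrite mulf_eq0 gt_eqF //= => /eqP.
Qed.

(** [W] keeps the first basis vector v and replaces the others by lifts w_i of the rows of [U],
    where [t] is free; [s] collects the products <w_i, v>. The equation for [E] is Pythagoras scaled
    by [a]: the components along v contribute [s *m s^T]. *)
Lemma projmx_congr (n : nat) (a : int) (r : 'rV[int]_n) (D U : 'M[int]_n)
    (t : 'cV[int]_n) (s := a *: t + U *m r^T)
    (W : 'M[int]_(1 + n) := block_mx 1%:M 0 t U) : D^T = D ->
  exists2 E : 'M[int]_n, W *m block_mx a%:M r r^T D *m W^T
      = block_mx a%:M s^T s E
    & a *: E = U *m projmx a r D *m U^T + s *m s^T.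
Proof.
move=> symD; exists (s *m t^T + (t *m r + U *m D) *m U^T).
  rewrite /W tr_block_mx !mulmx_block !trmx1 !trmx0.
  rewrite !mul1mx !mul0mx !mulmx0 !addr0 !mulmx1 mul_mx_scalar -/s.
  rewrite mul_scalar_mx; congr block_mx.
  by rewrite /s linearD linearZ /= trmx_mul trmxK.
rewrite /s /projmx !linearD !linearZ /= trmx_mul trmxK.
rewrite !(mulmxDl, mulmxDr, mulmxBl, mulmxBr, mulNmx, mulmxN, scalerDr).
rewrite -!(scalemxAl, scalemxAr) !(mulmxA, scalerA).
set X1 := U *m D *m _; set X2 := U *m r^T *m r *m _; set X3 := t *m r *m _.
set X4 := U *m r^T *m _; set X5 := t *m t^T.
by apply/matrixP=> i j; rewrite !mxE; ring.
Qed.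

Lemma centered_remainder (a x : int) : 0 < a ->
  exists t : int, 4 * (a * t + x) ^+ 2 <= a ^+ 2.
Proof.
move=> a_gt0; have a0 : a != 0 by rewrite gt_eqF.
have := divz_eq x a; have := modz_ge0 x a0; have := ltz_pmod x a_gt0.
move: (x %/ a)%Z (x %% a)%Z => q y lt_ya y_ge0 ->.
(* The two choices leave y and y - a, whichever has absolute value at most a/2. *)
have [le_y|lt_y] := leP (2 * y) a; [exists (- q) | exists (- q - 1)]; nia.
Qed.

(** In the step from rank n to n + 1 each of the n lifts costs a factor 4; the exponent grows by 2n
    + 1, which covers this. *)
Definition hermite_const (n : nat) : int := 4 ^+ (n * n).

(** Taking the first basis vector as short as possible, with square length a,
    and the other ones as lifts w_i of a reduced basis of the projection such
    that |<w_i, v>| <= a/2, minimality of a gives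
    a q(w_i) <= q'(w_i) + a^2/4 <= q'(w_i) + a q(w_i)/4
    where q' is the scaled projected form. *)
Lemma hermite_reduction (n : nat) (A : 'M[int]_n) : posdefmx A ->
  exists2 U : 'M[int]_n, U \in unitmx
    & \prod_(i < n) (U *m A *m U^T) i i <= hermite_const n * \det A.
Proof.
elim: n A => [|n IHn] A pA.
  by exists 1%:M; rewrite ?unitmx1 // big_ord0 det_mx00.
(* A shortest first vector over all bases; [absz] only serves to minimize a natural number, since
   diagonal entries are positive. *)
have [U0 uU0 minU0] : exists2 U0 : 'M[int]_n.+1, U0 \in unitmx
    & forall U, U \in unitmx ->
      (absz ((U0 *m A *m U0^T) 0 0)%R <= absz ((U *m A *m U^T) 0 0)%R)%N.
  apply: (@ex_minimizer _ (fun U : 'M[int]_n.+1 => U \in unitmx)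
    (fun U => absz ((U *m A *m U^T) 0 0))).
  by exists 1%:M; rewrite unitmx1.
set A0 := U0 *m A *m U0^T in minU0.
have pA0 : posdefmx A0 by apply: posdefmx_congr.
(* A transposition moves any basis vector to the front, so the minimum is over all members of all
   bases. *)
have minA0 (W : 'M[int]_n.+1) i : W \in unitmx ->
    A0 0 0 <= (W *m A0 *m W^T) i i.
  move=> uW; have uV : tperm_mx 0 i *m W \in unitmx.
    by rewrite unitmx_mul unitmx_perm.
  have uVU : tperm_mx 0 i *m W *m U0 \in unitmx by rewrite unitmx_mul uV.
  have := minU0 _ uVU.
  have -> : tperm_mx 0 i *m W *m U0 *m A *m (tperm_mx 0 i *m W *m U0)^T
      = (tperm_mx 0 i *m W) *m A0 *m (tperm_mx 0 i *m W)^T.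
    by rewrite /A0 (trmx_mul _ U0) !mulmxA.
  have pos1 := posdefmx_diag_gt0 0 (posdefmx_congr uV pA0).
  have pos0 := posdefmx_diag_gt0 0 pA0.
  have -> : (W *m A0 *m W^T) i i
      = ((tperm_mx 0 i *m W) *m A0 *m (tperm_mx 0 i *m W)^T) 0 0.
    suff row0 : row 0 (tperm_mx 0 i *m W) = row i W.
      by rewrite !congr_diagE row0.
    by rewrite -xrowE; apply/rowP=> j; rewrite !mxE tpermL.
  by rewrite -lez_nat !gtz0_abs.
have [a [r [D defA0]]] : exists a r D,
    A0 = block_mx a%:M r r^T D :> 'M[int]_(1 + n).
  exists (A0 0 0), (@ursubmx _ 1 n 1 n A0), (@drsubmx _ 1 n 1 n A0).
  rewrite trmx_ursub pA0.1 -[LHS](@submxK _ 1 n 1 n); congr block_mx.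
  rewrite [LHS]mx11_scalar; congr (_%:M); rewrite [LHS]mxE [LHS]mxE.
  by congr (A0 _ _); apply: val_inj.
have a00 : A0 0 0 = a.
  by rewrite defA0 block_mx_scalar00.
have a_gt0 : 0 < a by rewrite -a00; apply: posdefmx_diag_gt0.
have pP : posdefmx (projmx a r D).
  by apply: posdefmx_projmx; rewrite -?defA0.
have [U' uU' prodU'] := IHn _ pP.
have symD : D^T = D.
  have : (block_mx a%:M r r^T D)^T = block_mx a%:M r r^T D.
    by rewrite -defA0; case: pA0.
  by rewrite tr_block_mx trmxK => /eq_block_mx[].
have [t tP] : exists t : 'cV[int]_n, forall i,
    4 * (a *: t + U' *m r^T) i 0 ^+ 2 <= a ^+ 2.
  have [t tP] := fin_all_exists (fun i =>
    centered_remainder ((U' *m r^T) i 0) a_gt0).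
  by exists (\col_i t i) => i; have := tP i; rewrite !mxE.
set s := _ + _ in tP.
pose W : 'M[int]_(1 + n) := block_mx 1%:M 0 t U'.
have uW : W \in unitmx by rewrite unitmxE det_lblock det1 mul1r -unitmxE.
have [E defW aE] := projmx_congr a r U' t symD.
exists (W *m U0); first by rewrite unitmx_mul uW.
have -> : W *m U0 *m A *m (W *m U0)^T = block_mx a%:M s^T s E.
  by rewrite -defW -defA0 /A0 trmx_mul !mulmxA.
have detA0 : \det A0 = \det A.
  rewrite !det_mulmx det_tr; move: uU0; rewrite unitmxE => /orP[]/eqP ->; ring.
have a_le i : a <= E i i.
  rewrite -(block_mxEdr a%:M s^T s E) -defW -defA0 -[leLHS]a00.
  exact: minA0.
(* With x = <w_i, v>, y = q(w_i) and z = q'(w_i): a y = z + x^2 and 4 x^2 <= a^2 <= a y give 3 a y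
   <= 4 z. *)
have E_le i : a * E i i <= 4 * (U' *m projmx a r D *m U'^T) i i.
  have /matrixP/(_ i i) := aE.
  rewrite [LHS]mxE [RHS]mxE [(s *m s^T) i i]mxE big_ord1 [s^T _ _]mxE.
  have := a_le i; have := tP i.
  move: (s i 0 : int) (E i i) ((U' *m _ *m _) i i) => x y z; rewrite !expr2.
  move=> le_x le_ay ay; have : a * a <= a * y by rewrite ler_pM2l.
  by have := mulr_gt0 a_gt0 a_gt0; lia.
rewrite big_ord_recl block_mx_scalar00.
have -> : \prod_(i < n) block_mx a%:M s^T s E (lift ord0 i) (lift ord0 i)
    = \prod_(i < n) E i i.
  by apply: eq_bigr => i _; rewrite -!rshift1 block_mxEdr.
(* After multiplication by [a ^+ n], each [E i i] absorbs one factor [a], and [det_projmx] turns the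
   determinant into [a] times that of the projection; this last [a] cancels. *)
rewrite -detA0 defA0 -(ler_pM2l (exprn_gt0 n a_gt0)).
rewrite [leRHS]mulrCA det_projmx.
have : \prod_(i < n) (a * E i i)
    <= \prod_(i < n) (4 * (U' *m projmx a r D *m U'^T) i i).
  apply: ler_prod => i _; rewrite E_le andbT mulr_ge0 ?ltW //.
  exact: lt_le_trans (a_le i).
rewrite !big_split /= !prodr_const card_ord => le_prod.
rewrite mulrCA [leRHS]mulrCA ler_pM2l //; apply: le_trans le_prod _.
have detP : 0 <= hermite_const n * \det (projmx a r D).
  apply: le_trans prodU'; apply: prodr_ge0 => i _.
  exact/ltW/posdefmx_diag_gt0/posdefmx_congr.
apply: (@le_trans _ _ (4 ^+ n * (hermite_const n * \det (projmx a r D)))).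
  by rewrite ler_pM2l // exprn_gt0.
have -> : hermite_const n.+1 = 4 ^+ n.+1 * hermite_const n * 4 ^+ n.
  by rewrite /hermite_const -!exprD; congr (_ ^+ _); lia.
set h := hermite_const n in detP *; set p := \det _ in detP *.
rewrite [leRHS](_ : _ = 4 ^+ n.+1 * (4 ^+ n * (h * p))); last by ring.
apply: ler_peMl.
  by rewrite mulr_ge0 // exprn_ge0.
exact: exprn_ege1.
Qed.

(** * Bases of lattices *)

Lemma form_zmod_morphism (L : lattice) (x : L) : zmod_morphism (form x).
Proof. by move=> y z; rewrite -[in RHS](subrK z y) [in RHS]formDr addrK. Qed.

HB.instance Definition _ (L : lattice) (x : L) :=
  GRing.isZmodMorphism.Build L int (form x) (form_zmod_morphism x).

Lemma act_zmod_morphism (G : finGroupType) (u : G) (L : glattice u) (s : G) :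
  zmod_morphism (@act G u L s).
Proof. by move=> x y; rewrite -[in RHS](subrK y x) [in RHS]actD addrK. Qed.

HB.instance Definition _ (G : finGroupType) (u : G) (L : glattice u) (s : G) :=
  GRing.isZmodMorphism.Build L L (@act G u L s) (@act_zmod_morphism G u L s).

Lemma form_ge0 (L : lattice) (x : L) : 0 <= form x x.
Proof.
by have [->|/form_posdef/ltW//] := eqVneq x 0; rewrite raddf0.
Qed.

(** The arithmetic mean replaces the geometric mean of Cauchy-Schwarz. *)
Lemma form_norm_le (L : lattice) (x y : L) :
  2 * `|form x y| <= form x x + form y y.
Proof.
have formNr a c : form a (- c) = - form a c :> int by rewrite raddfN.
have formNl a c : form (- a) c = - form a c :> int.
  by rewrite formC formNr formC.
have := form_ge0 (x + y); have := form_ge0 (x - y).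
by rewrite !formDl !formDr !formNr !formNl (formC y x); lia.
Qed.

(** Coefficients form a row vector, so that a change of basis is a matrix product. *)
Definition lincomb (L : zmodType) (k : nat) (b : 'I_k -> L) (x : 'rV[int]_k) :=
  \sum_(i < k) b i *~ x 0 i.

Lemma lincomb_zmod_morphism (L : zmodType) (k : nat) (b : 'I_k -> L) :
  zmod_morphism (lincomb b).
Proof.
move=> x y; rewrite /lincomb -sumrB; apply: eq_bigr => i _.
by rewrite !mxE mulrzBr.
Qed.

HB.instance Definition _ (L : zmodType) (k : nat) (b : 'I_k -> L) :=
  GRing.isZmodMorphism.Build 'rV[int]_k L (lincomb b) (lincomb_zmod_morphism b).

Lemma raddf_lincomb (L M : zmodType) (f : {additive L -> M}) (k : nat)
    (b : 'I_k -> L) (x : 'rV[int]_k) :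
  f (lincomb b x) = lincomb (fun i => f (b i)) x.
Proof. by rewrite raddf_sum; apply: eq_bigr => i _; rewrite raddfMz. Qed.

Lemma lincomb_mulmx (L : zmodType) (k l : nat) (b : 'I_k -> L)
    (U : 'M[int]_(l, k)) (x : 'rV[int]_l) :
  lincomb (fun i => lincomb b (row i U)) x = lincomb b (x *m U).
Proof.
rewrite /lincomb; under eq_bigr do rewrite mulrz_suml.
rewrite exchange_big /=; apply: eq_bigr => j _.
rewrite mxE mulrz_sumr; apply: eq_bigr => i _.
by rewrite mxE -mulrzA mulrC.
Qed.

Lemma form_lincomb (L : lattice) (k : nat) (b : 'I_k -> L)
    (x y : 'rV[int]_k) :
  form (lincomb b x) (lincomb b y) = (x *m gram b *m y^T) 0 0.
Proof.
rewrite raddf_lincomb mxE; apply: eq_bigr => j _ /=.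
rewrite formC raddf_lincomb mulrzz !mxE; congr (_ * _).
by apply: eq_bigr => i _; rewrite mulrzz mxE formC mulrC.
Qed.

Lemma lincomb_row1 (L : zmodType) (k : nat) (b : 'I_k -> L) (i : 'I_k) :
  lincomb b (row i 1%:M) = b i.
Proof.
rewrite /lincomb (bigD1 i) //= big1 ?addr0 => [|j ne_ji]; rewrite !mxE.
  by rewrite eqxx.
by rewrite eq_sym (negPf ne_ji).
Qed.

Lemma zbasis_bij (L : zmodType) (k : nat) (b : 'I_k -> L) :
  zbasis b -> bijective (lincomb b).
Proof.
move=> [spanb freeb].
(* The boolean equality allows [xchoose] to pick coordinates. *)
have surj x : exists c : 'rV[int]_k, x == lincomb b c.
  have [c ->] := spanb x; exists (\row_i c i).
  by apply/eqP/eq_bigr => i _; rewrite mxE.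
have surjK x : lincomb b (xchoose (surj x)) = x.
  by rewrite -(eqP (xchooseP (surj x))).
exists (fun x => xchoose (surj x)) => // c.
apply/eqP; rewrite -subr_eq0; apply/eqP/rowP=> i; rewrite [RHS]mxE.
apply: (freeb (fun i => (xchoose (surj (lincomb b c)) - c) 0 i)).
suff : lincomb b (xchoose (surj (lincomb b c)) - c) = 0 by [].
by rewrite raddfB /= surjK subrr.
Qed.

Lemma bij_zbasis (L : zmodType) (k : nat) (b : 'I_k -> L) :
  bijective (lincomb b) -> zbasis b.
Proof.
move=> bijb; have [g gK Kg] := bijb; split=> [x|c c0 i].
  by exists (fun i => g x 0 i); rewrite -[LHS]Kg.
suff /rowP/(_ i) : \row_i c i = 0 by rewrite !mxE.
apply: (bij_inj bijb); rewrite raddf0 -[RHS]c0.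
by apply: eq_bigr => j _; rewrite mxE.
Qed.

Lemma zbasis_congr (L : zmodType) (k : nat) (b : 'I_k -> L) (U : 'M[int]_k) :
  U \in unitmx -> zbasis b -> zbasis (fun i => lincomb b (row i U)).
Proof.
move=> uU /zbasis_bij bijb; apply: bij_zbasis.
apply: eq_bij (bij_comp bijb _) _ _ => [|x]; last by rewrite lincomb_mulmx.
by exists (mulmx^~ (invmx U)) => x; rewrite (mulmxK uU, mulmxKV uU).
Qed.

(** The matrices expressing each basis in the other satisfy U V = 1, which bounds the outer size by
    the inner one. *)
Lemma zbasis_size_le (L : zmodType) (k l : nat) (b : 'I_k -> L)
    (b' : 'I_l -> L) :
  zbasis b -> zbasis b' -> (k <= l)%N.
Proof.
move=> /zbasis_bij bijb /zbasis_bij[g' g'K Kg']; have [g gK Kg] := bijb.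
pose U := \matrix_i g' (b i); pose V := \matrix_i g (b' i).
apply: (@mulmx1_min _ _ _ U V); apply/row_matrixP => i.
apply: (bij_inj bijb); rewrite lincomb_row1 row_mul -lincomb_mulmx rowK.
rewrite -[RHS]Kg'; apply: eq_bigr => j _.
by rewrite rowK Kg.
Qed.

Lemma zbasis_size (L : zmodType) (k l : nat) (b : 'I_k -> L) (b' : 'I_l -> L) :
  zbasis b -> zbasis b' -> k = l.
Proof.
by move=> zb zb'; apply/eqP; rewrite eqn_leq !(zbasis_size_le zb zb',
  zbasis_size_le zb' zb).
Qed.

Lemma posdefmx_gram (L : lattice) (k : nat) (b : 'I_k -> L) :
  zbasis b -> posdefmx (gram b).
Proof.
move=> /zbasis_bij bijb; split=> [|x x0].
  by apply/matrixP=> i j; rewrite !mxE formC.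
rewrite -form_lincomb; apply: form_posdef; apply: contraNneq x0.
by rewrite -(raddf0 (lincomb b)) => /(bij_inj bijb) ->.
Qed.

Lemma gram_lincomb (L : lattice) (k : nat) (b : 'I_k -> L) (U : 'M[int]_k)
    (i : 'I_k) :
  form (lincomb b (row i U)) (lincomb b (row i U))
    = (U *m gram b *m U^T) i i.
Proof. by rewrite form_lincomb congr_diagE. Qed.

(** Hermite reduction bounds the product of the square lengths; these are positive integers, so each
    is at most the product. *)
Lemma reduced_basis (L : lattice) (k : nat) (d : int) :
    has_rank L k -> has_gram_det L d ->
  exists2 b : 'I_k -> L, zbasis b
    & forall i, form (b i) (b i) <= hermite_const k * d.
Proof.
move=> [b' zb'] [l [b [zb <-]]]; have eq_lk := zbasis_size zb zb'.
case: _ / eq_lk => {b' zb'}.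
have pb := posdefmx_gram zb; have [U uU leU] := hermite_reduction pb.
exists (fun i => lincomb b (row i U)); first exact: zbasis_congr.
move=> i; apply: le_trans leU; rewrite gram_lincomb (bigD1 i) //=.
have pos j := posdefmx_diag_gt0 j (posdefmx_congr uU pb).
apply: ler_peMr; first exact/ltW.
apply: (big_rec (fun x => 1 <= x)) => // j x _ x1.
by apply: mulr_ege1; rewrite // -gtz0_ge1.
Qed.

(** * Classes of G-lattices *)

(** x - y is orthogonal to a basis, hence to itself. *)
Lemma eq_form_zbasis (L : lattice) (k : nat) (b : 'I_k -> L) (x y : L) :
  zbasis b -> (forall j, form x (b j) = form y (b j)) -> x = y.
Proof.
move=> zb eq_xy; have [g _ Kg] := zbasis_bij zb.
have norm0 : form (x - y) (x - y) = 0.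
  rewrite -[X in form _ X]Kg raddf_lincomb; apply: big1 => i _ /=.
  by rewrite formC raddfB /= !(formC (b i)) eq_xy subrr mul0rz.
apply/eqP; rewrite -subr_eq0; apply/negPn/negP => /form_posdef.
by rewrite norm0 ltxx.
Qed.

(** The case s = 1 says that the Gram matrices agree, so b_i -> b'_i extends to an isometry; it
    commutes with the action because both sides have the same products with every b'_j. *)
Lemma giso_zbasis (G : finGroupType) (u : G) (L M : glattice u) (k : nat)
    (b : 'I_k -> L) (b' : 'I_k -> M) : zbasis b -> zbasis b' ->
    (forall s i j, form (act s (b i)) (b j) = form (act s (b' i)) (b' j)) ->
  giso L M.
Proof.
move=> zb zb' eq_bb'.
have [g gK Kg] := zbasis_bij zb; have [g' g'K Kg'] := zbasis_bij zb'.
pose f x := lincomb b' (g x).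
have f_lincomb c : f (lincomb b c) = lincomb b' c by rewrite /f gK.
have fB : zmod_morphism f.
  by move=> x y; rewrite -(Kg x) -(Kg y) -raddfB !f_lincomb raddfB.
have f_form x y : form (f x) (f y) = form x y.
  rewrite -[in RHS](Kg x) -[in RHS](Kg y) !form_lincomb.
  congr ((_ *m _ *m _) _ _); apply/matrixP=> i j; rewrite !mxE.
  by have := eq_bb' 1%g i j; rewrite !act1.
have f_basis i : f (b i) = b' i by rewrite -lincomb_row1 f_lincomb lincomb_row1.
pose F : {additive L -> M} := HB.pack f (GRing.isZmodMorphism.Build L M f fB).
exists F; split=> // [|s x].
  by exists (fun y => lincomb b (g' y)) => x /=; rewrite /f ?gK ?g'K ?Kg ?Kg'.
apply: (eq_form_zbasis zb') => j /=; rewrite -[in LHS]f_basis f_form.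
rewrite -(Kg x) f_lincomb !raddf_lincomb !(formC (lincomb _ _)) !raddf_lincomb.
by apply: eq_bigr => i _ /=; rewrite formC eq_bb' formC.
Qed.

Lemma giso_sym (G : finGroupType) (u : G) (L M : glattice u) :
  giso L M -> giso M L.
Proof.
move=> [f [[g fK gK] f_form f_act]].
have gB : zmod_morphism g.
  by move=> x y; apply: (can_inj fK); rewrite raddfB !gK.
pose F : {additive M -> L} := HB.pack g (GRing.isZmodMorphism.Build M L g gB).
exists F; split=> [|x y|s x] /=; first by exists f.
  by rewrite -f_form !gK.
by apply: (can_inj fK); rewrite f_act !gK.
Qed.

Lemma giso_trans (G : finGroupType) (u : G) (L M N : glattice u) :
  giso L M -> giso M N -> giso L N.
Proof.
move=> [f [bij_f f_form f_act]] [g [bij_g g_form g_act]].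
exists (g \o f : {additive L -> N}); split=> [|x y|s x] /=.
- exact: bij_comp.
- by rewrite g_form f_form.
- by rewrite f_act g_act.
Qed.

Lemma eq_giso (G : finGroupType) (u : G) (L M : glattice u) :
  giso L M -> giso L = giso M.
Proof.
move=> iLM; apply: functional_extensionality => N.
apply: propositional_extensionality; split; last exact: giso_trans.
exact/giso_trans/giso_sym.
Qed.

Theorem theorem14p5 (G : finGroupType) (u : G)
    (abG : abelian [set: G]%g) (ordu : #[u]%g = 2) :
  finite_pred (@WPic G u).
Proof.
set n := (#|G| %/ 2)%N; set B := absz (hermite_const n).
have defB : hermite_const n = B by rewrite gez0_abs // exprn_ge0.
(* ['I_(B + B).+1] stands for the interval [-B, B], shifted by B. *)
pose K := {ffun G * 'I_n * 'I_n -> 'I_(B + B).+1}.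
pose code (k : K) (C : glattice u -> Prop) :=
  exists (L : glattice u) (b : 'I_n -> L), [/\ C = giso L, zbasis b
    & forall s i j, form (act s (b i)) (b j) = (k (s, i, j))%:Z - B%:Z].
apply: (@finite_pred_codes K _ _ code) => [_ [L [rkL detL _] ->]|k C D _ _].
  have [b zb leb] := reduced_basis rkL detL.
  (* Both b_i and b_j have square length at most B, and the action of s preserves it. *)
  have bound s i j : `|form (act s (b i)) (b j)| <= B%:Z.
    have := form_norm_le (act s (b i)) (b j); rewrite act_form.
    by have := leb i; have := leb j; rewrite defB; lia.
  exists [ffun p => inord (absz (form (act p.1.1 (b p.1.2)) (b p.2) + B%:Z))].
  exists L, b; split=> // s i j; rewrite ffunE /= inordK.
    by have := bound s i j; lia.
  by have := bound s i j; lia.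
(* Two classes with one code have bases with the same products, hence isomorphic representatives. *)
move=> [L [b [-> zb kb]]] [M [b' [-> zb' kb']]]; apply: eq_giso.
by apply: (giso_zbasis zb zb') => s i j; rewrite kb kb'.
Qed.
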